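(* For any Hausdorff space $X$, $$|X|\le 2^{d(X)\cdot s\Delta(X)}.$$
   Context: $d(X)$ is the density of $X$ (the least cardinality of a dense subset). For a family $\mathcal{U}$ of subsets of $X$ and $x\in X$, $\mathrm{St}(x,\mathcal{U})=\bigcup\{U\in\mathcal{U}:x\in U\}$. For an infinite cardinal $\kappa$, $X$ has a strong rank $1$ $G_\kappa$-diagonal if there is a sequence $\{\mathcal{U}_\alpha:\alpha<\kappa\}$ of open covers of $X$ such that for all $x\ne y$ in $X$ there is $\alpha<\kappa$ with $y\notin\overline{\mathrm{St}(x,\mathcal{U}_\alpha)}$. $s\Delta(X)$ is the least infinite cardinal $\kappa$ such that $X$ has a strong rank $1$ $G_\kappa$-diagonal. *)

(* Defs.v *)
From mathcomp Require Import all_boot.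
From mathcomp Require Import boolp classical_sets functions cardinality.
From mathcomp Require Import topology_structure separation_axioms.

Set Implicit Arguments.
Unset Strict Implicit.
Unset Printing Implicit Defensive.

Local Open Scope classical_set_scope.
Local Open Scope card_scope.

(** A cardinal is represented by any type of that cardinality: cardinals are
    compared through [card_le] (#<=), products of cardinals are product types,
    and [2 ^ K] is the power set [set K]. *)

Definition is_least_cardinal (P : Type -> Prop) (K : Type) : Prop :=
  P K /\ forall L : Type, P L -> [set: K] #<= [set: L].

(** A chosen type of least cardinality satisfying [P].  The value [unit] is a
    dummy, reached only when no type satisfies [P]; this never happens for
    [density], nor for [sDelta] of a Hausdorff space: see [densityP] and
    [sDeltaP] below. *)
Definition least_cardinal (P : Type -> Prop) : Type :=
  if pselect (exists K, is_least_cardinal P K) is left h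
  then projT1 (cid h) else unit.

Definition open_cover (X : topologicalType) (U : set (set X)) : Prop :=
  (forall V, U V -> open V) /\ \bigcup_(V in U) V = [set: X].

Definition St (X : Type) (x : X) (U : set (set X)) : set X :=
  \bigcup_(V in [set V | U V /\ V x]) V.

Definition strong_rank1_diagonal (X : topologicalType) (K : Type) : Prop :=
  exists U : K -> set (set X),
    (forall a, open_cover (U a)) /\
    forall x y : X, x <> y -> exists a, ~ closure (St x (U a)) y.

Definition density (X : topologicalType) : Type :=
  least_cardinal (fun K => exists2 D : set X, dense D & [set: K] #= D).

Definition sDelta (X : topologicalType) : Type :=
  least_cardinal (fun K =>
    infinite_set [set: K] /\ strong_rank1_diagonal X K).

Lemma inj_cardT (A B : Type) (f : A -> B) :
  injective f -> [set: A] #<= [set: B].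
Proof.
move=> fi; have : range f #= [set: A] by apply: inj_card_eq => x y _ _ /fi.
by move=> e; rewrite -(card_le_eql e); exact: card_leT.
Qed.

Lemma least_of_family (I : Type) (F : I -> Type) (i0 : I) :
  exists i, forall j, [set: F i] #<= [set: F j].
Proof.
pose T := forall i, F i.
pose inj_all (S : set T) :=
  forall i f g, S f -> S g -> f i = g i -> f = g.
have [G GP tG|S [Sinj Smax]] := @Zorn_bigcup T inj_all.
  move=> i f g [A GA Af] [B GB Bg].
  by have [AB|BA] := tG _ _ GA GB;
    [apply: (GP B GB i) => //; exact: AB|apply: (GP A GA i) => //; exact: BA].
have [i Si] : exists i, forall y : F i, exists f, S f /\ f i = y.
  apply: contrapT => /forallNP nS.
  have exg i : exists y : F i, forall f, S f -> f i <> y.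
    have /existsNP[y /forallNP yP] := nS i.
    by exists y => f Sf fy; exact: (yP f).
  pose g : T := fun i => projT1 (cid (exg i)).
  have gP i f : S f -> f i <> g i by exact: (projT2 (cid (exg i))).
  apply: (Smax (S `|` [set g])).
    split; first by move=> f Sf; left.
    by move=> /(_ g (or_intror erefl)) /(gP i0).
  move=> i f h [Sf|->] [Sh|->] // e; first exact: Sinj e.
    by have := gP i f Sf e.
  by have := gP i h Sh (esym e).
exists i => j.
have [s sP] := choice Si.
apply: (@inj_cardT _ _ (fun y => s y j)) => y z e.
have [Sy <-] := sP y; have [Sz <-] := sP z.
by rewrite (Sinj _ _ _ Sy Sz e).
Qed.

Lemma card_le_totalT (A B : Type) :
  [set: A] #<= [set: B] \/ [set: B] #<= [set: A].
Proof.
have [[] h] := least_of_family (fun b : bool => if b then A else B) true.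
  by left; exact: (h false).
by right; exact: (h true).
Qed.

Lemma least_cardinalP (P : Type -> Prop) :
  (forall K L : Type, [set: K] #= [set: L] -> P K -> P L) ->
  (exists K, P K) -> is_least_cardinal P (least_cardinal P).
Proof.
move=> Peq [K0 PK0]; rewrite /least_cardinal; case: pselect => [h|[]].
  by case: cid.
pose F (A : {A : set K0 | P A}) : Type := set_type (sval A).
have PT : P [set: K0] by apply: Peq PK0; exact: card_setT_sym.
have [A leA] := least_of_family F (exist (fun A : set K0 => P A) _ PT).
exists (F A); split; first exact: (svalP A).
move=> L PL; have [K0L|] := card_le_totalT K0 L.
  apply: card_le_trans K0L; apply: (card_le_trans (leA (exist _ _ PT))).
  by rewrite /F/= (card_le_eql (card_setT _)).
move=> /card_subP[C CL _]; have CL' := card_eq_trans (card_setT C) CL.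
have PC : P C by apply: Peq PL; exact: card_esym.
by rewrite -(card_le_eqr CL'); exact: (leA (exist _ _ PC)).
Qed.

Lemma densityP (X : topologicalType) :
  is_least_cardinal (fun K => exists2 D : set X, dense D & [set: K] #= D)
    (density X).
Proof.
apply: least_cardinalP => [K L KL [D dD KD]|].
  by exists D => //; exact: card_eq_trans (card_esym KL) KD.
exists (X : Type); exists [set: X] => //.
by move=> O [x Ox] _; exists x.
Qed.

Lemma sDeltaP (X : topologicalType) : hausdorff_space X ->
  is_least_cardinal
    (fun K => infinite_set [set: K] /\ strong_rank1_diagonal X K) (sDelta X).
Proof.
move=> hX; apply: least_cardinalP => [K L KL [infK [U [Uc UP]]]|].
  split; first by rewrite -(eq_finite_set KL).
  have /card_bijP[f [g fK gK]] := KL.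
  exists (fun b => U (set_val (g (to_setT b)))).
  split=> [b|x y /UP[a aP]]; first exact: Uc.
  exists (set_val (f (to_setT a))).
  have -> : to_setT (set_val (f (to_setT a))) = f (to_setT a) by exact: val_inj.
  by rewrite fK.
exists (X * X + nat)%type; split.
  by apply/infiniteP; apply: (@inj_cardT _ _ inr) => m n [].
have coverT : open_cover [set [set: X]].
  split; first by move=> _ ->; exact: openT.
  by rewrite bigcup_set1.
have /choice[U UP] : forall p : X * X, exists U : set (set X),
    open_cover U /\ (p.1 <> p.2 -> ~ closure (St p.1 U) p.2).
  move=> [x y] /=; have [->|/eqP xy] := pselect (x = y).
    by exists [set setT].
  move: (hX); rewrite open_hausdorff => /(_ x y xy) [[A B] /=].
  rewrite !inE => -[Ax By] [oA oB AB0].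
  exists [set A; ~` [set x]]; split.
    split=> [_ [->|->] //|].
      by apply: closed_openC; exact/accessible_closed_set1/hausdorff_accessible.
    rewrite -subTset => z _; have [->|zx] := pselect (z = x).
      by exists A => //; left.
    by exists (~` [set x]) => //; right.
  move=> _ /(_ B (open_nbhs_nbhs (conj oB By))) [z [[V [[->|->]]]]] //.
    by move=> _ Az Bz; have : (A `&` B) z by []; rewrite AB0.
  by move=> /(_ erefl).
exists (fun a => if a is inl p then U p else [set setT]); split.
  by move=> [p|_] //; have [] := UP p.
by move=> x y xy; exists (inl (x, y)); exact: (UP (x, y)).2.
Qed.

(* Main.v *)
Require Import Defs.
From mathcomp Require Import all_boot.
From mathcomp Require Import boolp classical_sets functions cardinality.
From mathcomp Require Import topology_structure separation_axioms.

Local Open Scope classical_set_scope.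
Local Open Scope card_scope.

(** Let [D] be dense. A star is open, so its closure is determined by its trace
    on [D]. Hence [x] is determined by the pairs [(d, a)] such that [d] in [D]
    lies in [St (x, U_a)]: if [y] has the same pairs, then [y] lies in the
    closure of [St (x, U_a)] for every [a]. *)

Lemma open_St (X : topologicalType) (U : set (set X)) (x : X) :
  open_cover U -> open (St x U).
Proof. by move=> [oU _]; apply: bigcup_open => V [/oU]. Qed.

Lemma mem_St (X : topologicalType) (U : set (set X)) (x : X) :
  open_cover U -> St x U x.
Proof.
move=> [_ cU]; have [V UV Vx] : (\bigcup_(V in U) V) x by rewrite cU.
by exists V.
Qed.

(** If [O] is open around a point of [A], then the intersection of [O] and [A] is open and nonempty,
    so it meets [D], in a point of [B]. *)
Lemma open_sub_closure_dense (X : topologicalType) (D A B : set X) :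
  dense D -> open A -> A `&` D `<=` B -> A `<=` closure B.
Proof.
move=> dD oA ADB y Ay N; rewrite nbhsE => -[O [oO Oy] ON].
have [|d [[Od Ad] Dd]] := dD (O `&` A) _ (openI oO oA); first by exists y.
by exists d; split; [exact: ADB|exact: ON].
Qed.

Theorem proposition4p1 (X : topologicalType) (hX : hausdorff_space X) :
  [set: X] #<= [set: set (density X * sDelta X)].
Proof.
have [[D dD /card_bijP[f [g _ gK]]] _] := densityP X.
have [[_ [U [Uc UP]]] _] := sDeltaP hX.
pose trace x : set (density X * sDelta X) :=
  [set p | St x (U p.2) (set_val (f (to_setT p.1)))].
apply: (@inj_cardT _ _ trace) => x y xy.
(* If [x] and [y] differ, some [a] keeps [y] out of the closure of [St x (U a)]; it remains to put
   [y] in it. *)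
apply: contrapT => /UP[a]; apply.
apply: (open_sub_closure_dense _ D (St y (U a))) => //.
- exact: open_St.
- move=> d [Sd Dd].
  (* [set_val e] is the index of [d] in [density X]; equal traces at [(set_val e, a)] move [d] from
     the star of [y] to that of [x]. *)
  pose e := g (SigSub (mem_set Dd)).
  have eE : set_val (f (to_setT (set_val e))) = d.
    have -> : to_setT (set_val e) = e by exact: val_inj.
    by rewrite gK.
  have : trace y (set_val e, a) by rewrite /trace/= eE.
  by rewrite -xy /trace/= eE.
- exact: mem_St.
Qed.
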